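(* Let $(X,\Pi)$ be a $\gamma$-non-lazy $(\delta,\gamma)$-eposet. The approximate eigenvalues of the canonical lower walk $\check{N}_k^{k-i}$ are: \[ \lambda_j(\check{N}_k^{k-i}) \in \frac{R(i,j)}{R(k,j)} \pm c\gamma, \] where $c \leq O\left(\frac{i^4k^2R_{\text{max}}}{\delta_i(1-\delta_{i-1})}\gamma\right)$.
   Context: $(X,\Pi)$ is a $d$-dimensional graded poset (levels $X(0),\dots,X(d)$, unique minimal element, pure) that is regular: downward and middle regular, so that every element of $X(k)$ lies above exactly $R(k,i)$ elements of $X(i)$ (with $R(i,i)=1$, $R(j,i)=0$ for $j<i$); $R_{\max}=\max_{0\le i\le k}R(k,i)$. The measure $\Pi=(\pi_0,\dots,\pi_d)$ is induced from $\pi_d$ by $\pi_i(x)=\frac{1}{R(i+1,i)}\sum_{y\gtrdot x}\pi_{i+1}(y)$. The up and down operators are $U_if(y)=\frac{1}{R(i+1,i)}\sum_{x\lessdot y}f(x)$ and $D_{i+1}f(x)=\frac{1}{\pi_{i+1}(X_x)}\sum_{y\gtrdot x}\pi_{i+1}(y)f(y)$, with $U^k_\ell=U_{k-1}\cdots U_\ell$ and $D^k_\ell=D_{\ell+1}\cdots D_k$. $X$ is a $(\delta,\gamma)$-eposet ($\delta\in[0,1]^{d-1}$, $\gamma<1$) if $\|D_{i+1}U_i-(1-\delta_i)I-\delta_iU_{i-1}D_i\|\le\gamma$ for all $1\le i\le d-1$; it is $\gamma$-non-lazy if $\max_{\sigma\in X(i)}\mathbb{1}_\sigma^TU_{i-1}D_i\mathbb{1}_\sigma\le\gamma$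 for all $i$. The canonical lower walk is $\check{N}_k^{j}=U^k_{k-j}D^k_{k-j}$ on functions on $X(k)$. The approximate eigenvalue $\lambda_j(M)$ of a walk $M$ is the value such that every $f_j=U^k_jg_j$ with $g_j\in\mathrm{Ker}(D_j)$ (the $j$-th level of the HD-Level-Set Decomposition $C_k=\bigoplus_j U^k_j\,\mathrm{Ker}(D_j)$) satisfies $\|Mf_j-\lambda_j(M)f_j\|\le O(\gamma)\|f_j\|$; for $\check{N}_k^{k-i}$ it equals $\prod_{s=1}^{k-i}(1-\delta^{k-s}_{k-s-j})$ where $\delta^k_j=\prod_{t=k-j}^k\delta_t$.
   Formalization: The error proved is O(i^4k^2R_max/(δ_i(1-δ_{i-1})))·γ, with one factor γ: the second γ inside the bound on c is dropped, since the literal γ^2 bound is false; i≥1, δ_i>0 and δ_{i-1}<1 are assumed so that the bound is defined (δ_0=0). *)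

(* Defs.v *)
From HB Require Import structures.
From mathcomp Require Import all_boot all_order all_algebra.
From mathcomp Require Import reals.
Set Implicit Arguments.
Unset Strict Implicit.
Unset Printing Implicit Defensive.
Import Order.TTheory GRing.Theory Num.Theory.
Local Open Scope ring_scope.

Section Poset.
Context {disp : Order.disp_t} {X : finPOrderType disp}.
Implicit Types (x y : X) (rk : X -> nat).

Definition covers x y : bool :=
  (x < y)%O && ~~ [exists z : X, (x < z)%O && (z < y)%O].

Definition minimal x : bool := [forall y : X, ~~ (y < x)%O].
Definition maximal x : bool := [forall y : X, ~~ (x < y)%O].

Record graded_poset (d : nat) rk : Prop := GradedPoset {
  rank_lt : forall x y, (x < y)%O -> (rk x < rk y)%N;
  rank_covers : forall x y, covers x y -> rk y = (rk x).+1;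
  unique_minimal : exists2 b : X, rk b = 0%N & forall x, minimal x = (x == b);
  pure : forall x, maximal x -> rk x = d }.

(* Number of maximal chains  x = z_0 < z_1 < ... < z_n = y. *)
Definition nchains (n : nat) x y : nat :=
  #|[set z : n.-tuple X | path covers x z && (last x z == y)]|.

(* [R k i] is the number R(k,i) of rank-i elements below any rank-k element. *)
Record regular_poset rk (R : nat -> nat -> nat) : Prop := RegularPoset {
  downward_regular : exists r : nat -> nat, forall x,
    #|[set y : X | covers y x]| = r (rk x);
  middle_regular : exists m : nat -> nat -> nat, forall x y, (x < y)%O ->
    nchains (rk y - rk x) x y = m (rk y) (rk x);
  rank_count : forall x i,
    #|[set y : X | (rk y == i) && (y <= x)%O]| = R (rk x) i }.

End Poset.

(* Functions on X(k) are represented by functions on all of X of which only the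
   values at elements of rank k matter: every notion below that concerns level k
   reads its arguments at rank k only. *)
Section Operators.
Context {K : realType} {disp : Order.disp_t} {X : finPOrderType disp}.
Context (rk : X -> nat) (R : nat -> nat -> nat) (pi : nat -> X -> K).
Implicit Types (f g : X -> K) (x y : X).

Record induced_measure (d : nat) : Prop := InducedMeasure {
  top_ge0 : forall x, rk x = d -> 0 <= pi d x;
  top_sum1 : \sum_(x : X | rk x == d) pi d x = 1;
  induced : forall i x, (i < d)%N -> rk x = i ->
    pi i x = (R i.+1 i)%:R^-1 * \sum_(y : X | covers x y) pi i.+1 y }.

(* U_i : functions on X(i) -> functions on X(i+1) *)
Definition up (i : nat) f : X -> K :=
  fun y => (R i.+1 i)%:R^-1 * \sum_(x : X | covers x y) f x.

(* D_i : functions on X(i) -> functions on X(i-1), for i >= 1.  The quotient is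
   0/0 = 0 only at elements of measure zero. *)
Definition down (i : nat) f : X -> K :=
  fun x => (\sum_(y : X | covers x y) pi i y * f y)
           / (\sum_(y : X | covers x y) pi i y).

Fixpoint up_iter (l n : nat) f : X -> K :=
  if n is n'.+1 then up (l + n') (up_iter l n' f) else f.
Fixpoint down_iter (l n : nat) f : X -> K :=
  if n is n'.+1 then down_iter l n' (down (l + n) f) else f.

(* U^k_l = U_(k-1) ... U_l  and  D^k_l = D_(l+1) ... D_k *)
Definition upto (k l : nat) f : X -> K := up_iter l (k - l) f.
Definition downto (k l : nat) f : X -> K := down_iter l (k - l) f.

Definition lower_walk (k m : nat) f : X -> K :=
  upto k (k - m) (downto k (k - m) f).

(* The norm of L^2(X(k), pi_k). *)
Definition norm2 (k : nat) f : K :=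
  Num.sqrt (\sum_(x : X | rk x == k) pi k x * f x ^+ 2).

Definition opnorm_le (k : nat) (M : (X -> K) -> X -> K) (c : K) : Prop :=
  forall f, norm2 k (M f) <= c * norm2 k f.

Definition indic (s : X) : X -> K := fun x => (x == s)%:R.

Definition nonlazy (d : nat) (gamma : K) : Prop :=
  forall i, (1 <= i <= d)%N -> forall s, rk s = i ->
    up i.-1 (down i (indic s)) s <= gamma.

(* The vector delta is indexed by 1..d-1; products of the delta_t also run over
   t = 0, where delta_0 = 0 by convention, since D_1 U_0 = I. *)
Record is_eposet (d : nat) (delta : nat -> K) (gamma : K) : Prop := IsEposet {
  delta0 : delta 0%N = 0;
  delta_range : forall i, (1 <= i <= d.-1)%N -> 0 <= delta i <= 1;
  gamma_lt1 : gamma < 1;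
  eposet_bound : forall i, (1 <= i <= d.-1)%N ->
    opnorm_le i (fun f x => down i.+1 (up i f) x
                            - (1 - delta i) * f x
                            - delta i * up i.-1 (down i f) x) gamma }.

(* g, on X(j), is in Ker(D_j); D_0 is the zero map, so Ker(D_0) is everything. *)
Definition ker_down (j : nat) g : Prop :=
  forall x, (rk x).+1 = j -> down j g x = 0.

(* lambda is an eigenvalue of M on the j-th HD-level-set U^k_j Ker(D_j), up to a
   relative error e. *)
Definition approx_eigenvalue (k j : nat) (M : (X -> K) -> X -> K)
    (lambda e : K) : Prop :=
  forall g, ker_down j g ->
    norm2 k (fun x => M (upto k j g) x - lambda * upto k j g x)
      <= e * norm2 k (upto k j g).

End Operators.

(* delta^b_(b-a) = delta_a * ... * delta_b, equal to 1 if b < a.  It is indexed by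
   its lower end because b - a may be negative. *)
Definition delta_prod {K : realType} (delta : nat -> K) (a b : nat) : K :=
  \prod_(a <= t < b.+1) delta t.

(* lambda_j of the lower walk of height m on X(k):
   \prod_(s = 1)^m (1 - delta^(k-s)_(k-s-j)) *)
Definition lower_walk_eigenvalue {K : realType} (delta : nat -> K)
    (k m j : nat) : K :=
  \prod_(1 <= s < m.+1) (1 - delta_prod delta j (k - s)).

Definition Rmax (R : nat -> nat -> nat) (k : nat) : nat :=
  \max_(0 <= i < k.+1) R k i.

(* Main.v *)
(* The eposet relation iterates to
     D_(m+1) U^(m+1)_j = (1 - P) U^m_j + P U^m_(j-1) D_j + O(gamma),
   with P = delta_j ... delta_m.
   On Ker(D_j) the second term vanishes, which gives the approximate eigenvalues
   as products of factors 1 - P.  The error is first obtained relative to the norm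
   of g in Ker(D_j); it is relative to the norm of U^k_j g because
   <U^k_j g, U^k_j g> = <g, D^k_j U^k_j g> is about prod (1 - P) <g, g>.

   To identify 1 - P, apply the relation to the indicator of some s in X(j) of
   positive measure and pair it with the indicator V of the elements above s.  By
   middle regularity U^m_j averages over the rank-j elements below, so the three
   terms become 1/R(m+1,j), (1 - P)/R(m,j) and, by non-laziness, O(gamma), all
   times <V, V>.  Hence 1 - P = R(m,j)/R(m+1,j) + O(gamma R(m,j)), and the product
   over m = i, ..., k-1 telescopes to R(i,j)/R(k,j).  For m = j this also shows
   that gamma is bounded below by a function of R when delta_j = 1, the only case
   where prod (1 - P) may vanish; the error bound is then trivial. *)
Require Import Defs.
From HB Require Import structures.
From mathcomp Require Import all_boot all_order all_algebra.
From mathcomp Require Import reals.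
From mathcomp Require Import ring lra zify.
Set Implicit Arguments.
Unset Strict Implicit.
Unset Printing Implicit Defensive.
Import Order.TTheory GRing.Theory Num.Theory.
Local Open Scope ring_scope.

(** * Elementary inequalities for products and weighted sums *)

(** Exchanging one factor at a time costs at most [e], because all the remaining factors lie in the
    unit interval. *)
Lemma le_prod_dist (K : realDomainType) (I : eqType) (s : seq I)
    (a b : I -> K) (e : K) :
  (forall i, i \in s -> 0 <= a i <= 1) -> (forall i, i \in s -> 0 <= b i <= 1) ->
  (forall i, i \in s -> `|a i - b i| <= e) ->
  `|\prod_(i <- s) a i - \prod_(i <- s) b i| <= (size s)%:R * e.
Proof.
elim: s => [|i s IHs] Ha Hb Hab; first by rewrite !big_nil subrr normr0 mul0r.
have sub j : j \in s -> j \in i :: s by rewrite in_cons => ->; rewrite orbT.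
have {}IHs := IHs (fun j js => Ha j (sub j js)) (fun j js => Hb j (sub j js))
  (fun j js => Hab j (sub j js)).
have ii : i \in i :: s by rewrite in_cons eqxx.
have /andP[ai0 ai1] := Ha i ii.
have /andP[B0 B1] : 0 <= \prod_(j <- s) b j <= 1.
  rewrite big_seq; apply/andP; split.
    by apply: prodr_ge0 => j /sub /Hb /andP[].
  by apply: prodr_ile1 => j /sub /Hb.
rewrite !big_cons; set A := \prod_(j <- s) a j in IHs *.
set B := \prod_(j <- s) b j in IHs B0 B1 *.
have -> : a i * A - b i * B = a i * (A - B) + (a i - b i) * B by ring.
apply: (le_trans (ler_normD _ _)); rewrite !normrM (ger0_norm ai0) (ger0_norm B0).
rewrite /= -natr1 mulrDl mul1r; apply: lerD.
  by apply: le_trans IHs; rewrite ler_piMl.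
by apply: le_trans (Hab i ii); rewrite ler_piMr.
Qed.

(** The weights may vanish, so the form is only semidefinite. The proof uses that the weighted
    square sum of [f - t * g] is nonnegative for every [t]. *)
Lemma cauchy_schwarz (K : realFieldType) (T : finType) (P : pred T)
    (w f g : T -> K) : (forall x, P x -> 0 <= w x) ->
  (\sum_(x | P x) w x * (f x * g x)) ^+ 2
    <= (\sum_(x | P x) w x * f x ^+ 2) * (\sum_(x | P x) w x * g x ^+ 2).
Proof.
move=> w0; set B := \sum_(x | P x) _; set A := (X in _ <= X * _).
set D := (X in _ <= _ * X).
have D0 : 0 <= D by apply: sumr_ge0 => x /w0 wx; rewrite mulr_ge0 ?sqr_ge0.
have quad t : 0 <= A - 2 * t * B + t ^+ 2 * D.
  have -> : A - 2 * t * B + t ^+ 2 * D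
      = \sum_(x | P x) w x * (f x - t * g x) ^+ 2.
    rewrite /A /B /D !mulr_sumr -sumrB -big_split /=.
    by apply: eq_bigr => x _; ring.
  by apply: sumr_ge0 => x /w0 wx; rewrite mulr_ge0 ?sqr_ge0.
case: (eqVneq D 0) => [DE|Dn0].
  suff /eqP -> : B == 0 by rewrite DE expr0n mulr0.
  (* With [D = 0] the quadratic is affine in [t]; this [t] makes it equal to [-1]. *)
  apply: contraT => Bn0; have := quad ((A + 1) / (2 * B)).
  rewrite DE mulr0 addr0.
  have -> : A - 2 * ((A + 1) / (2 * B)) * B = -1 by field.
  by rewrite lerNr oppr0 ler10.
(* The minimizer of the quadratic in [t]. *)
have := quad (B / D).
have -> : A - 2 * (B / D) * B + (B / D) ^+ 2 * D = A - B ^+ 2 / D by field.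
by rewrite subr_ge0 ler_pdivrMr // lt_def Dn0.
Qed.

(** * Ranks, counts and chains in a regular graded poset *)

Section Poset.
Context {disp : Order.disp_t} {X : finPOrderType disp}.
Context {d : nat} {rk : X -> nat} {R : nat -> nat -> nat}.
Context (grX : graded_poset d rk) (regX : regular_poset rk R).
Implicit Types x y : X.

Lemma covers_le x y : covers x y -> (x <= y)%O.
Proof. by case/andP => /ltW. Qed.

Lemma rk_eq x y : (x <= y)%O -> rk x = rk y -> x = y.
Proof.
rewrite le_eqVlt => /orP[/eqP //|/(rank_lt grX)] + e.
by rewrite e ltnn.
Qed.

Lemma rk_le x y : (x <= y)%O -> (rk x <= rk y)%N.
Proof. by rewrite le_eqVlt => /orP[/eqP ->//|/(rank_lt grX) /ltnW]. Qed.

(** Ranks strictly increase, so nothing fits between consecutive ranks. Sums over covers thereby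
    become sums over a level. *)
Lemma covers_rk i x y : rk y = i.+1 -> covers x y = (rk x == i) && (x <= y)%O.
Proof.
move=> ry; apply/idP/andP => [cxy|[/eqP rx lxy]].
  by rewrite covers_le //; move: (rank_covers grX cxy); rewrite ry => -[->].
rewrite /covers lt_neqAle lxy andbT; apply/andP; split.
  by apply/eqP => e; move: rx; rewrite e ry => /eqP; rewrite eqn_leq ltnn.
apply/existsP => -[z /andP[/(rank_lt grX) xz /(rank_lt grX) zy]].
lia.
Qed.

Lemma lower_cover y : (0 < rk y)%N -> exists x, covers x y.
Proof.
have [b rb minb] := unique_minimal grX; move=> ry.
have /forallPn[z /negPn zy] : ~~ minimal y.
  by rewrite minb; apply: contraTneq ry => ->; rewrite rb.
(* An element of largest rank strictly below [y] must be covered by [y]. *)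
pose w := [arg max_(w > z | (w < y)%O) rk w].
exists w; rewrite /w; case: arg_maxnP => //= {}w wy wmax.
rewrite /covers wy; apply/existsP => -[u /andP[wu /wmax]].
by rewrite leqNgt (rank_lt grX wu).
Qed.

Lemma rank_below y l : (l <= rk y)%N -> exists2 x, rk x = l & (x <= y)%O.
Proof.
move: {2}(rk y - l)%N (erefl (rk y - l)%N) => n.
elim: n y => [|n IHn] y e ly; first by exists y => //; lia.
have [x cxy] : exists x, covers x y by apply: lower_cover; lia.
have rxy := rank_covers grX cxy.
have [||z rz zx] := IHn x; [lia|lia|].
by exists z => //; apply: le_trans zx (covers_le cxy).
Qed.

(** An element of largest rank is maximal, so purity puts it at rank [d]. *)
Lemma rank_top : exists x, rk x = d.
Proof.
have [b _ _] := unique_minimal grX.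
exists [arg max_(w > b) rk w]; case: arg_maxnP => //= w _ wmax.
apply: (pure grX); apply/forallP => y; apply/negP => /(rank_lt grX).
by rewrite ltnNge (wmax y).
Qed.

Lemma rank_ex l : (l <= d)%N -> exists x, rk x = l.
Proof.
by have [x <-] := rank_top; move=> /rank_below[z]; exists z.
Qed.

(** Regularity constrains [R k] only through elements of rank [k]; the facts on [R] therefore start
    from a witness given by [rank_ex]. *)
Lemma R_gt0 k l : (l <= k <= d)%N -> (0 < R k l)%N.
Proof.
case/andP => lk /rank_ex[x rx]; move: lk; rewrite -rx => /rank_below[z rz zx].
by rewrite -(rank_count regX x); apply/card_gt0P; exists z; rewrite inE rz eqxx.
Qed.

Lemma R_le i k l : (i <= k <= d)%N -> (R i l <= R k l)%N.
Proof.
case/andP => ik /rank_ex[x rx]; move: ik; rewrite -rx => /rank_below[z <- zx].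
rewrite -!(rank_count regX); apply/subset_leq_card/subsetP => w.
by rewrite !inE => /andP[-> /le_trans]; exact.
Qed.

Lemma R_diag k : (k <= d)%N -> R k k = 1%N.
Proof.
case/rank_ex => x <-; rewrite -(rank_count regX).
apply/eqP/cards1P; exists x; apply/setP => y; rewrite !inE.
apply/andP/eqP => [[/eqP e yx]|->]; last by rewrite eqxx.
exact: rk_eq.
Qed.

Lemma R_out k l : (k <= d)%N -> (k < l)%N -> R k l = 0%N.
Proof.
case/rank_ex => x <- kl; rewrite -(rank_count regX).
apply/eqP; rewrite cards_eq0; apply/eqP/setP => y; rewrite !inE.
by apply/negP => /andP[/eqP ry /rk_le]; lia.
Qed.

Lemma path_covers_le x s : path covers x s -> (x <= last x s)%O.
Proof.
elim: s x => //= y s IHs x /andP[/covers_le xy /IHs]; exact: le_trans.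
Qed.

Lemma nchains0 x y : nchains 0 x y = (x == y).
Proof.
rewrite /nchains; case: eqP => [->|/eqP ne].
  apply/eqP/cards1P; exists [tuple]; apply/setP => z; rewrite !inE tuple0.
  by rewrite /= !eqxx.
by apply/eqP; rewrite cards_eq0; apply/eqP/setP => z; rewrite !inE tuple0 /= (negPf ne).
Qed.

(** Removing the endpoint [y] from a chain is a bijection; the shorter chains are then sorted by
    their last element [w]. *)
Lemma nchainsS n x y : nchains n.+1 x y = (\sum_(w | covers w y) nchains n x w)%N.
Proof.
have -> : nchains n.+1 x y
    = #|[set t : n.-tuple X | path covers x t && covers (last x t) y]|.
  rewrite -(card_imset (f := fun t : n.-tuple X => [tuple of rcons t y])); last first.
    move=> s t /(congr1 val) /= /eqP; rewrite eqseq_rcons eqxx andbT => /eqP e.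
    exact: val_inj.
  congr #|pred_of_set _|; apply/setP => z; apply/idP/imsetP.
    rewrite inE; case: z => z /= sz; case/lastP: z sz => // s w sz.
    have ss : size s == n by move: (sz); rewrite size_rcons eqSS.
    rewrite rcons_path last_rcons => /andP[/andP[ps cs] /eqP <-].
    exists (Tuple ss); first by rewrite inE ps.
    exact: val_inj.
  by case=> t; rewrite inE => /andP[pt ct] ->;
    rewrite inE /= rcons_path pt ct last_rcons eqxx.
rewrite -sum1_card (partition_big (fun t : n.-tuple X => last x t)
  (fun w => covers w y)) /=.
  apply: eq_bigr => w cw; rewrite /nchains -sum1_card; apply: eq_bigl => t; rewrite !inE.
  by case: eqP => [->|]; rewrite ?cw ?andbT ?andbF.
by move=> t; rewrite inE => /andP[].
Qed.

(** Middle regularity speaks of [x < y] only: length zero is treated by hand, and no chain joins [x]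
    to [y] unless [x <= y]. *)
Lemma nchains_const l n : exists N : nat, forall x y,
  rk x = l -> rk y = (l + n)%N -> nchains n x y = if (x <= y)%O then N else 0%N.
Proof.
have [M HM] := middle_regular regX.
case: n => [|n].
  exists 1%N => x y rx; rewrite addn0 => ry; rewrite nchains0.
  case: eqP => [->|ne]; first by rewrite lexx.
  by case: ifP => // /rk_eq; rewrite rx ry => /(_ erefl).
exists (M (l + n.+1)%N l) => x y rx ry; case: ifP => [xy|].
  have <- : M (rk y) (rk x) = M (l + n.+1)%N l by rewrite rx ry.
  rewrite -HM; first by congr nchains; rewrite rx ry; lia.
  by rewrite lt_neqAle xy andbT; apply/eqP => e; move: rx; rewrite e ry; lia.
move/negP => nxy; apply/eqP; rewrite cards_eq0; apply/eqP/setP => z; rewrite !inE.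
by apply/negP => /andP[/path_covers_le xz /eqP zy]; apply: nxy; rewrite -zy.
Qed.

End Poset.

(** * Up and down operators: adjointness, contraction, averaging *)

Definition inner {K : realType} {disp : Order.disp_t} {X : finPOrderType disp}
    (rk : X -> nat) (pi : nat -> X -> K) (k : nat) (f g : X -> K) : K :=
  \sum_(x | rk x == k) pi k x * (f x * g x).

Section Operators.
Context {K : realType} {disp : Order.disp_t} {X : finPOrderType disp}.
Context {d : nat} {rk : X -> nat} {R : nat -> nat -> nat} { pi : nat -> X -> K}.
Context (grX : graded_poset d rk) (regX : regular_poset rk R).
Context (measX : induced_measure rk R pi d).
Implicit Types (x y : X) (f g : X -> K).

Local Notation inner := (inner rk pi).
Local Notation norm := (norm2 rk pi).

Lemma sum_covers_exchange i (F : X -> X -> K) :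
  \sum_(y | rk y == i.+1) \sum_(x | covers x y) F x y
    = \sum_(x | rk x == i) \sum_(y | covers x y) F x y.
Proof.
rewrite (exchange_big_dep (fun x => rk x == i)) /=; last first.
  by move=> y x /eqP ry; rewrite (covers_rk grX _ ry) => /andP[].
apply: eq_bigr => x /eqP rx; apply: eq_bigl => y; apply: andb_idl => c.
by rewrite (rank_covers grX c) rx.
Qed.

Lemma sum_covers_const i y (a : K) : rk y = i.+1 ->
  \sum_(x | covers x y) a = (R i.+1 i)%:R * a.
Proof.
move=> ry; rewrite -[in R _ _]ry -(rank_count regX) mulr_natl -sumr_const.
by apply: eq_bigl => x; rewrite inE -(covers_rk grX _ ry).
Qed.

Lemma pi_ge0 k x : (k <= d)%N -> rk x = k -> 0 <= pi k x.
Proof.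
move: {2}(d - k)%N (erefl (d - k)%N) => n; elim: n k x => [|n IHn] k x e kd rx.
  have kE : k = d by lia.
  by move: rx; rewrite kE; exact: (top_ge0 measX).
rewrite (induced measX) //; last by lia.
rewrite mulr_ge0 ?invr_ge0 ?ler0n //; apply: sumr_ge0 => y c.
by apply: IHn; [lia|lia|rewrite (rank_covers grX c) rx].
Qed.

Lemma natR_neq0 i : (i < d)%N -> (R i.+1 i)%:R != 0 :> K.
Proof. by move=> id; rewrite pnatr_eq0 -lt0n (R_gt0 grX regX) // leqnSn. Qed.

Lemma sum_up_pi i x : (i < d)%N -> rk x = i ->
  \sum_(y | covers x y) pi i.+1 y = (R i.+1 i)%:R * pi i x.
Proof.
by move=> id rx; rewrite [in RHS](induced measX) // mulrA divff ?mul1r ?natR_neq0.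
Qed.

Lemma pi_sum1 k : (k <= d)%N -> \sum_(x | rk x == k) pi k x = 1.
Proof.
move: {2}(d - k)%N (erefl (d - k)%N) => n; elim: n k => [|n IHn] k e kd.
  have -> : k = d by lia.
  exact: (top_sum1 measX).
rewrite -[RHS](IHn k.+1); [|lia|lia].
rewrite (eq_bigr (fun x => \sum_(y | covers x y) (R k.+1 k)%:R^-1 * pi k.+1 y)).
  rewrite -sum_covers_exchange; apply: eq_bigr => y /eqP ry.
  by rewrite (sum_covers_const _ ry) mulrA divff ?mul1r // natR_neq0 //; lia.
by move=> x /eqP rx; rewrite (induced measX) // -?mulr_sumr //; lia.
Qed.

(** Multiplying by [pi i x] removes the quotient in [down]. If [pi i x = 0], all covers of [x] have
    measure zero as well, so both sides vanish. *)
Lemma down_mul i g x : (i < d)%N -> rk x = i ->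
  pi i x * down pi i.+1 g x
    = (R i.+1 i)%:R^-1 * \sum_(y | covers x y) pi i.+1 y * g y.
Proof.
move=> id rx; rewrite /down (sum_up_pi id rx).
have Rn0 := natR_neq0 id.
have [p0|pn0] := eqVneq (pi i x) 0; last by field; apply/andP.
rewrite p0 mul0r big1 ?mulr0 // => y c.
have /eqP := sum_up_pi id rx; rewrite p0 mulr0 psumr_eq0 => [|z cz]; last first.
  by apply: pi_ge0 => //; rewrite (rank_covers grX cz) rx.
by move=> /allP /(_ y (mem_index_enum _)); rewrite c => /eqP ->; rewrite mul0r.
Qed.

Lemma adjoint i f g : (i < d)%N ->
  inner i.+1 (up R i f) g = inner i f (down pi i.+1 g).
Proof.
move=> id; rewrite /inner.
transitivity (\sum_(y | rk y == i.+1) \sum_(x | covers x y)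
                (R i.+1 i)%:R^-1 * (pi i.+1 y * (f x * g y))).
  by apply: eq_bigr => y _; rewrite -!mulr_sumr -mulr_suml /up; ring.
rewrite sum_covers_exchange; apply: eq_bigr => x /eqP rx.
rewrite [RHS]mulrCA down_mul // -mulr_sumr [RHS]mulrCA; congr (_ * _).
by rewrite mulr_sumr; apply: eq_bigr => y _; ring.
Qed.

Lemma up_congr i f g y : rk y = i.+1 ->
  (forall x, rk x = i -> f x = g x) -> up R i f y = up R i g y.
Proof.
move=> ry fg; congr (_ * _); apply: eq_bigr => x.
by rewrite (covers_rk grX _ ry) => /andP[/eqP rx _]; exact: fg.
Qed.

Lemma up_lin i a b f g y :
  up R i (fun x => a * f x + b * g x) y = a * up R i f y + b * up R i g y.
Proof. by rewrite /up big_split /= -!mulr_sumr; ring. Qed.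

Lemma down_lin i a b f g x :
  down pi i (fun x => a * f x + b * g x) x = a * down pi i f x + b * down pi i g x.
Proof.
rewrite /down mulrA [b * _]mulrA -mulrDl; congr (_ / _).
by rewrite !mulr_sumr -big_split; apply: eq_bigr => y _ /=; ring.
Qed.

Lemma inner_self k f : inner k f f = \sum_(x | rk x == k) pi k x * f x ^+ 2.
Proof. by apply: eq_bigr => x _; rewrite expr2. Qed.

Lemma inner_ge0 k f : (k <= d)%N -> 0 <= inner k f f.
Proof.
move=> kd; rewrite inner_self; apply: sumr_ge0 => x /eqP rx.
by rewrite mulr_ge0 ?sqr_ge0 ?pi_ge0.
Qed.

Lemma norm_sqr k f : (k <= d)%N -> norm k f ^+ 2 = inner k f f.
Proof. by move=> kd; rewrite sqr_sqrtr -inner_self ?inner_ge0. Qed.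

Lemma norm_ge0 k f : 0 <= norm k f.
Proof. exact: sqrtr_ge0. Qed.

Lemma norm_congr k f g :
  (forall x, rk x = k -> f x = g x) -> norm k f = norm k g.
Proof.
by move=> fg; congr Num.sqrt; apply: eq_bigr => x /eqP rx; rewrite fg.
Qed.

Lemma inner_le_norm k f g : (k <= d)%N -> `|inner k f g| <= norm k f * norm k g.
Proof.
move=> kd; rewrite -ler_sqr ?nnegrE ?mulr_ge0 ?norm_ge0 //.
rewrite real_normK ?num_real // exprMn !norm_sqr // !inner_self.
by apply: cauchy_schwarz => x /eqP rx; exact: pi_ge0.
Qed.

Lemma norm_scale k a f : norm k (fun x => a * f x) = `|a| * norm k f.
Proof.
rewrite -sqrtr_sqr -sqrtrM ?sqr_ge0 //; congr Num.sqrt.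
by rewrite mulr_sumr; apply: eq_bigr => x _; ring.
Qed.

Lemma norm_triangle k f g : (k <= d)%N ->
  norm k (fun x => f x + g x) <= norm k f + norm k g.
Proof.
move=> kd; rewrite -ler_sqr ?nnegrE ?addr_ge0 ?norm_ge0 //.
rewrite sqrrD !norm_sqr //.
have -> : inner k (fun x => f x + g x) (fun x => f x + g x)
    = inner k f f + inner k f g *+ 2 + inner k g g.
  rewrite /inner -sumrMnl -!big_split; apply: eq_bigr => x _ /=; ring.
rewrite lerD2r lerD2l ler_pMn2r //; apply: le_trans (inner_le_norm f g kd).
exact: ler_norm.
Qed.

Lemma norm0 k f : (forall x, rk x = k -> f x = 0) -> norm k f = 0.
Proof.
move=> f0; rewrite /norm2 big1 ?sqrtr0 // => x /eqP rx.
by rewrite f0 // expr0n mulr0.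
Qed.

(** Jensen's inequality: the square of an average is at most the average of the squares, and by
    adjointness with the constant [1] averaging upwards preserves the expectation. *)
Lemma norm_up i f : (i < d)%N -> norm i.+1 (up R i f) <= norm i f.
Proof.
move=> id; apply: ler_wsqrtr.
apply: (@le_trans _ _ (inner i.+1 (up R i (fun x => f x ^+ 2)) (fun=> 1))).
  apply: ler_sum => y /eqP ry; rewrite mulr1.
  apply: ler_wpM2l; first exact: pi_ge0.
  have Rp : 0 < (R i.+1 i)%:R :> K by rewrite lt_def natR_neq0 // ler0n.
  rewrite /up exprMn expr2 -mulrA ler_pM2l ?invr_gt0 // mulrC ler_pdivrMr //.
  have := @cauchy_schwarz _ _ (fun x => covers x y) (fun=> 1) f (fun=> 1)
    (fun _ _ => ler01).
  rewrite (sum_covers_const _ ry) expr1n !mulr1.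
  under eq_bigr do rewrite mul1r mulr1.
  by under [X in _ <= X * _ -> _]eq_bigr do rewrite mul1r.
rewrite adjoint //; apply: ler_sum => x /eqP rx.
rewrite mulrCA down_mul //; under eq_bigr do rewrite mulr1.
by rewrite (sum_up_pi id rx) mulKf ?natR_neq0 // mulrC.
Qed.

(** By duality, [|D f|^2 = <U D f, f> <= |D f| |f|], since [up] is a contraction. *)
Lemma norm_down i f : (i < d)%N -> norm i (down pi i.+1 f) <= norm i.+1 f.
Proof.
move=> id; have id' := ltnW id.
have : norm i (down pi i.+1 f) ^+ 2 <= norm i (down pi i.+1 f) * norm i.+1 f.
  rewrite norm_sqr // -adjoint //; apply: le_trans (ler_norm _) _.
  apply: le_trans (inner_le_norm _ _ id) _.
  by rewrite ler_wpM2r ?norm_ge0 ?norm_up.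
rewrite expr2; have [->|n0] := eqVneq (norm i (down pi i.+1 f)) 0.
  by rewrite norm_ge0.
by rewrite ler_pM2l // lt_def n0 norm_ge0.
Qed.

Lemma uptoS k l f : (l <= k)%N -> upto R k.+1 l f = up R k (upto R k l f).
Proof. by move=> lk; rewrite /upto subSn //= subnKC. Qed.

Lemma upto_id k f : upto R k k f = f.
Proof. by rewrite /upto subnn. Qed.

(** [down_iter] unfolds at its highest level; inductions that descend level by level need the lowest
    operator exposed instead. *)
Lemma down_iterS l n f :
  down_iter pi l n.+1 f = down pi l.+1 (down_iter pi l.+1 n f).
Proof.
elim: n f => [|n IHn] f; first by rewrite /= addn1.
by rewrite [LHS]/= [RHS]/= addSnnS -IHn.
Qed.

Lemma downtoS k l f : (l < k)%N ->
  downto pi k l f = down pi l.+1 (downto pi k l.+1 f).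
Proof. by move=> lk; rewrite /downto -down_iterS -subSn. Qed.

Lemma downto_id k f : downto pi k k f = f.
Proof. by rewrite /downto subnn. Qed.

Lemma norm_upto k l f : (l <= k <= d)%N -> norm k (upto R k l f) <= norm l f.
Proof.
case/andP => /subnKC <-; elim: (k - l)%N => [|n IHn].
  by rewrite addn0 upto_id.
rewrite addnS uptoS ?leq_addr // => kd.
by apply: le_trans (norm_up _ kd) (IHn (ltnW kd)).
Qed.

Lemma norm_downto k l f : (l <= k <= d)%N -> norm l (downto pi k l f) <= norm k f.
Proof.
case/andP; move: {2}(k - l)%N (erefl (k - l)%N) => n.
elim: n l => [|n IHn] l e lk kd.
  have -> : l = k by lia.
  by rewrite downto_id.
rewrite downtoS; last by lia.
by apply: le_trans (norm_down _ _) (IHn _ _ _ _); lia.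
Qed.

Lemma upto_lin k l a b f g y : (l <= k)%N ->
  upto R k l (fun x => a * f x + b * g x) y
    = a * upto R k l f y + b * upto R k l g y.
Proof.
move=> /subnKC <-; elim: (k - l)%N y => [|n IHn] y.
  by rewrite addn0 !upto_id.
rewrite addnS !uptoS ?leq_addr // -up_lin; congr (_ * _).
by apply: eq_bigr => x _; exact: IHn.
Qed.

Lemma upto_upto k m l f : (l <= m <= k)%N ->
  upto R k m (upto R m l f) = upto R k l f.
Proof.
case/andP => lm /subnKC <-; elim: (k - m)%N => [|n IHn].
  by rewrite addn0 upto_id.
by rewrite addnS !uptoS ?leq_addr ?IHn // (leq_trans lm) ?leq_addr.
Qed.

Lemma adjoint_upto k l f g : (l <= k <= d)%N ->
  inner k (upto R k l f) g = inner l f (downto pi k l g).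
Proof.
case/andP; move: {2}(k - l)%N (erefl (k - l)%N) => n.
elim: n l f => [|n IHn] l f e lk kd.
  have -> : l = k by lia.
  by rewrite downto_id upto_id.
rewrite downtoS -?adjoint; [|lia|lia].
rewrite -IHn; [|lia|lia|lia]; congr inner.
rewrite -(@upto_upto k l.+1 l); last by lia.
by rewrite uptoS // upto_id.
Qed.

(** Iterated averaging weights each [x] by the number of chains from [x] to [y]. Middle regularity
    makes this number constant, so the average is uniform. *)
Lemma uptoE k l f y : (l <= k <= d)%N -> rk y = k ->
  upto R k l f y = (R k l)%:R^-1 * \sum_(x | (rk x == l) && (x <= y)%O) f x.
Proof.
case/andP => lk kd ry.
have sumE n z g : rk z = (l + n)%N -> (l + n <= d)%N -> up_iter R l n g z
    = (\prod_(t < n) (R (l + t).+1 (l + t))%:R^-1)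
      * \sum_(x | rk x == l) (nchains n x z)%:R * g x.
  elim: n z => [|n IHn] z rz nd.
    rewrite big_ord0 mul1r /= (bigD1 z) /=; last by rewrite rz addn0.
    rewrite nchains0 eqxx mul1r big1 ?addr0 // => x /andP[_ xz].
    by rewrite nchains0 (negPf xz) mul0r.
  rewrite [LHS]/= /up (eq_bigr (fun w => (\prod_(t < n) (R (l + t).+1 (l + t))%:R^-1)
      * \sum_(x | rk x == l) (nchains n x w)%:R * g x)); last first.
    by move=> w cw; apply: IHn; [move: (rank_covers grX cw); lia | lia].
  rewrite -mulr_sumr exchange_big /= big_ord_recr /= [LHS]mulrCA -mulrA.
  congr (_ * (_ * _)); apply: eq_bigr => x _.
  by rewrite -mulr_suml -natr_sum nchainsS.
have [N HN] := nchains_const grX regX l (k - l).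
have [a Ha] : exists a : K, forall g,
    upto R k l g y = a * \sum_(x | (rk x == l) && (x <= y)%O) g x.
  exists (\prod_(t < k - l) (R (l + t).+1 (l + t))%:R^-1 * N%:R) => g.
  rewrite /upto sumE; [|lia|lia]; rewrite -mulrA; congr (_ * _).
  rewrite big_mkcondr mulr_sumr; apply: eq_bigr => x /eqP rx.
  by rewrite HN //; [case: ifP => //; rewrite ?mul0r ?mulr0 | lia].
have cardE : \sum_(x | (rk x == l) && (x <= y)%O) (1 : K) = (R k l)%:R.
  by rewrite -ry -(rank_count regX) -sumr_const; apply: eq_bigl => x; rewrite inE.
(* The common weight [a] is determined by the constant function [1], which averaging preserves:
   [a * R k l = 1]. *)
have one : upto R k l (fun=> 1 : K) y = 1.
  move: lk kd ry {HN sumE a Ha cardE} => /subnKC <-.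
  elim: (k - l)%N y => [|n IHn] y; first by rewrite addn0 upto_id.
  rewrite addnS => kd ry; rewrite uptoS ?leq_addr //.
  rewrite (up_congr (g := fun=> 1) ry); last by move=> x; exact: IHn (ltnW kd).
  by rewrite /up (sum_covers_const _ ry) mulr1 mulVf // natR_neq0.
rewrite Ha; congr (_ * _).
have : a * (R k l)%:R = 1 by rewrite -[RHS]one Ha cardE.
have Rn0 : (R k l)%:R != 0 :> K by rewrite pnatr_eq0 -lt0n (R_gt0 grX regX) ?lk.
by move=> /(canRL (mulfK Rn0)); rewrite mul1r.
Qed.

End Operators.

(** * Eposets: ranges of [gamma] and of the products of [delta] *)

(** This is [lower_walk_eigenvalue] indexed by the level [t = k - s], so that a step down from level
    [t.+1] to [t] contributes the factor at [t]. *)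
Definition walk_factor {K : realType} (delta : nat -> K) (j i k : nat) : K :=
  \prod_(i <= t < k) (1 - delta_prod delta j t).

Section Eposet.
Context {K : realType} {disp : Order.disp_t} {X : finPOrderType disp}.
Context {d : nat} {rk : X -> nat} {R : nat -> nat -> nat} { pi : nat -> X -> K}.
Context {delta : nat -> K} {gamma : K}.
Context (grX : graded_poset d rk) (regX : regular_poset rk R).
Context (measX : induced_measure rk R pi d).
Context (epX : is_eposet rk R pi d delta gamma).
Context (nlX : nonlazy rk R pi d gamma).
Implicit Types (x y : X) (f g : X -> K).

Local Notation inner := (inner rk pi).
Local Notation indic := (@indic K disp X).
Local Notation norm := (norm2 rk pi).
Local Notation dprod := (delta_prod delta).
Local Notation walk_factor := (walk_factor delta).

Lemma inner_upto1 k l f : (l <= k <= d)%N ->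
  inner k (upto R k l f) (fun=> 1)
    = inner l f (fun=> 1).
Proof.
case/andP => /subnKC <-; elim: (k - l)%N => [|n IHn].
  by rewrite addn0 upto_id.
rewrite addnS => nd; rewrite uptoS ?leq_addr // (adjoint grX regX measX) //.
rewrite -(IHn (ltnW nd)); apply: eq_bigr => x /eqP rx.
rewrite mulrCA (down_mul grX regX measX) //; under eq_bigr do rewrite mulr1.
rewrite (sum_up_pi grX regX measX nd rx) mulKf ?(natR_neq0 grX regX) //; ring.
Qed.

Lemma down_ge0 i f x : (i < d)%N -> rk x = i ->
  (forall y, rk y = i.+1 -> 0 <= f y) -> 0 <= down pi i.+1 f x.
Proof.
move=> id rx f0; have p0 y : covers x y -> 0 <= pi i.+1 y.
  by move=> c; apply: (pi_ge0 grX measX) => //; rewrite (rank_covers grX c) rx.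
apply: divr_ge0; apply: sumr_ge0 => y c; last exact: p0.
by rewrite mulr_ge0 ?p0 ?f0 // (rank_covers grX c) rx.
Qed.

(** [gamma] bounds a diagonal entry of [U D], which is nonnegative; [0 < d] provides an element of
    rank 1. *)
Lemma gamma_ge0 : (0 < d)%N -> 0 <= gamma.
Proof.
move=> d0; have [s rs] := rank_ex grX d0.
apply: le_trans (nlX _ rs) => //.
rewrite mulr_ge0 ?invr_ge0 ?ler0n //; apply: sumr_ge0 => x c.
apply: down_ge0 => //.
by move: (rank_covers grX c); rewrite rs => -[].
Qed.

Lemma delta_01 t : (t < d)%N -> 0 <= delta t <= 1.
Proof.
case: t => [|t] td; first by rewrite (delta0 epX) lexx ler01.
by apply: (delta_range epX); lia.
Qed.

Lemma delta_prod_01 a b : (b < d)%N -> 0 <= dprod a b <= 1.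
Proof.
move=> bd; rewrite /delta_prod big_nat; apply/andP; split.
  apply: prodr_ge0 => t /andP[_ tb].
  by have /andP[] : 0 <= delta t <= 1 by apply: delta_01; lia.
by apply: prodr_ile1 => t /andP[_ tb]; apply: delta_01; lia.
Qed.

Lemma delta_prod1 a : dprod a a = delta a.
Proof. by rewrite /delta_prod big_nat1. Qed.

Lemma delta_prodS a b : (a <= b.+1)%N -> dprod a b.+1 = dprod a b * delta b.+1.
Proof. by move=> ab; rewrite /delta_prod big_nat_recr. Qed.

Lemma delta_prod_out a b : (b < a)%N -> dprod a b = 1.
Proof. by move=> ba; rewrite /delta_prod big_geq. Qed.

Lemma delta_prod0 b : dprod 0 b = 0.
Proof. by rewrite /delta_prod big_nat_recl // (delta0 epX) mul0r. Qed.

(** * The iterated eposet relation *)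

(** The new case is [i = 0]: level 0 is a single point of measure 1, so [D_1 U_0] is the identity,
    and [delta 0 = 0] kills the last term. The error is zero there. *)
Lemma eposet_bound_all i f : (i < d)%N ->
  norm i (fun x => down pi i.+1 (up R i f) x - (1 - delta i) * f x
                   - delta i * up R i.-1 (down pi i f) x) <= gamma * norm i f.
Proof.
case: i => [|i] id; last by apply: (eposet_bound epX); lia.
rewrite norm0 ?mulr_ge0 ?gamma_ge0 ?norm_ge0 // => x rx.
have [b _ minb] := unique_minimal grX.
have rk0 z : rk z = 0%N -> z = b.
  move=> rz; apply/eqP; rewrite -minb; apply/forallP => y; apply/negP.
  by move=> /(rank_lt grX); rewrite rz.
have px : pi 0%N x = 1.
  rewrite -(pi_sum1 grX regX measX (leq0n d)) (big_pred1 x) // => z /=.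
  by apply/eqP/eqP => [/rk0 ->|->//]; rewrite (rk0 x).
rewrite (delta0 epX) mul0r !subr0 mul1r; apply/eqP; rewrite subr_eq0; apply/eqP.
rewrite -[LHS]mul1r -px (down_mul grX regX measX _ id rx).
rewrite (eq_bigr (fun y => pi 1%N y * f x)).
  rewrite -mulr_suml (sum_up_pi grX regX measX id rx) px mulr1 mulrA.
  by rewrite mulVf ?mul1r // (natR_neq0 grX regX).
move=> y c; congr (_ * _); have ry : rk y = 1%N by rewrite (rank_covers grX c) rx.
rewrite /up (eq_bigr (fun=> f x)).
  by rewrite (sum_covers_const grX regX _ ry) mulKf // (natR_neq0 grX regX).
move=> z; rewrite (covers_rk grX _ ry) => /andP[/eqP /rk0 -> _].
by rewrite (rk0 x rx).
Qed.

(** Induction on [m]: the eposet relation at the new level produces [U D F], into which [up] of the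
    previous relation is substituted. The old error gets multiplied by some [delta <= 1], and one
    more [gamma] is added. *)
Lemma down_upto m j f : (j <= m < d)%N ->
  norm m (fun x => down pi m.+1 (upto R m.+1 j f) x
    - ((1 - dprod j m) * upto R m j f x
       + dprod j m * upto R m j.-1 (down pi j f) x))
  <= (m - j).+1%:R * gamma * norm j f.
Proof.
case/andP => /subnKC <-; rewrite addKn; elim: (m - j)%N => [|n IHn].
  rewrite addn0 => jd; rewrite mul1r uptoS // !upto_id delta_prod1.
  apply: le_trans (eposet_bound_all f jd); rewrite le_eqVlt.
  apply/predU1P; left; apply: norm_congr => x _; case: (j) => [|i].
    by rewrite (delta0 epX) !mul0r; ring.
  by rewrite /= uptoS // upto_id; ring.
rewrite addnS => md; set m' := (j + n)%N in IHn md *.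
have jm : (j <= m')%N by rewrite leq_addr.
set F := upto R m'.+1 j f in IHn *.
set P := dprod j m' in IHn *; set G := upto R m' j.-1 _ in IHn.
set E := (fun x => _) in IHn.
have {}IHn := IHn (ltnW md).
have upE x : up R m' E x = up R m' (down pi m'.+1 F) x
    - ((1 - P) * F x + P * upto R m'.+1 j.-1 (down pi j f) x).
  have -> : up R m' E x = up R m' (fun x => 1 * down pi m'.+1 F x + (- 1) *
      (fun x => (1 - P) * upto R m' j f x + P * G x) x) x.
    by congr (_ * _); apply: eq_bigr => z _; rewrite /E; ring.
  rewrite up_lin up_lin /F !uptoS //; last by apply: leq_trans jm; exact: leq_pred.
  by rewrite -/G; ring.
have step := eposet_bound_all F md.
set E1 := (fun x => _) in step.
rewrite (norm_congr (g := fun x => E1 x + delta m'.+1 * up R m' E x)).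
  apply: le_trans (norm_triangle grX measX _ _ (ltnW md)) _.
  rewrite norm_scale -natr1 [X in X * gamma]addrC mulrDl mulrDl mul1r.
  have g0 : 0 <= gamma by apply: gamma_ge0; lia.
  apply: lerD.
    apply: le_trans step _; rewrite ler_wpM2l //.
    by apply: (norm_upto grX regX measX); lia.
  apply: le_trans IHn; apply: le_trans (norm_up grX regX measX _ (ltnW md)).
  have /andP[dl0 dl1] := delta_01 md.
  by rewrite ger0_norm // ler_piMl // norm_ge0.
move=> x _; rewrite upE /E1 delta_prodS -/P; last by lia.
by rewrite (uptoS (k := m'.+1)) -/F; [rewrite /=; ring | lia].
Qed.

Lemma down_upto_ker m j g : (j <= m < d)%N -> ker_down rk pi j g ->
  norm m (fun x => down pi m.+1 (upto R m.+1 j g) x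
                   - (1 - dprod j m) * upto R m j g x)
  <= (m - j).+1%:R * gamma * norm j g.
Proof.
move=> jmd kg; apply: le_trans (down_upto g jmd).
rewrite le_eqVlt; apply/predU1P; left; apply: norm_congr => x rx.
(* For [j = 0] the term [down pi 0 g] need not vanish in this encoding, but its coefficient does. *)
case: j jmd kg => [|j] jmd kg; first by rewrite delta_prod0 mul0r addr0.
rewrite [upto R m j.+1.-1 _ x](uptoE grX regX) //=; last by lia.
by rewrite big1 ?mulr0 ?addr0 // => z /andP[/eqP rz _]; apply: kg; rewrite rz.
Qed.

(** * Walk factors and descent from level [k] *)

Lemma walk_factor_01 j i k : (k <= d)%N -> 0 <= walk_factor j i k <= 1.
Proof.
move=> kd; have H t : (i <= t < k)%N -> 0 <= 1 - dprod j t <= 1.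
  move=> ?; have /andP[? ?] : 0 <= dprod j t <= 1 by apply: delta_prod_01; lia.
  by lra.
rewrite /walk_factor big_nat; apply/andP; split.
  by apply: prodr_ge0 => t /H /andP[].
exact: prodr_ile1.
Qed.

(** At [t = j.-1] the product of the [delta] is empty, so the factor is [1 - 1]. *)
Lemma walk_factor_out j i k : (i < j <= k)%N -> walk_factor j i k = 0.
Proof.
move=> ijk; rewrite /walk_factor (bigD1_seq j.-1) /= ?iota_uniq //; last first.
  by rewrite mem_index_iota; lia.
by rewrite delta_prod_out ?subrr ?mul0r //; lia.
Qed.

Lemma lower_walk_eigenvalueE k i j : (i <= k)%N ->
  lower_walk_eigenvalue delta k (k - i) j = walk_factor j i k.
Proof.
move=> ik; rewrite /lower_walk_eigenvalue /walk_factor big_nat_rev big_add1 /=.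
rewrite -[i in RHS]add0n big_addn; apply: eq_big_nat => t ?; congr (1 - dprod _ _).
lia.
Qed.


(** Descending induction on [m]: each further [down] is a contraction on the old error and adds at
    most [k * gamma * norm j g]. *)
Lemma downto_upto_ker k m j g : (m <= k)%N -> (j <= k)%N -> (k <= d)%N ->
  ker_down rk pi j g ->
  norm m (fun x => downto pi k m (upto R k j g) x
                   - walk_factor j m k * upto R m j g x)
  <= ((k - m) * k)%:R * gamma * norm j g.
Proof.
move=> mk jk kd kg; move: {2}(k - m)%N (erefl (k - m)%N) => n.
elim: n m mk => [|n IHn] m mk e.
  have -> : m = k by lia.
  rewrite subnn !mul0r /walk_factor big_geq // norm0 // => x _.
  by rewrite downto_id mul1r subrr.
have md : (m < d)%N by lia.
have g0 : 0 <= gamma by apply: gamma_ge0; lia.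
have n0 : 0 <= norm j g by exact: norm_ge0.
have {}IHn : norm m.+1 (fun x => downto pi k m.+1 (upto R k j g) x
    - walk_factor j m.+1 k * upto R m.+1 j g x) <= ((k - m.+1) * k)%:R * gamma * norm j g.
  by apply: IHn; lia.
set H := downto pi k m.+1 _ in IHn; set c := walk_factor j m.+1 k in IHn.
set E := (fun x => _) in IHn.
have cE : walk_factor j m k = (1 - dprod j m) * c.
  by rewrite /walk_factor big_ltn //; lia.
have /andP[c0 c1] : 0 <= c <= 1 by exact: walk_factor_01.
set E1 := fun x => down pi m.+1 (upto R m.+1 j g) x - (1 - dprod j m) * upto R m j g x.
have E1_small : norm m (fun x => c * E1 x) <= k%:R * gamma * norm j g.
  have [jm|mj] := leqP j m.
    rewrite norm_scale ger0_norm //.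
    apply: (@le_trans _ _ (norm m E1)); first by rewrite ler_piMl ?norm_ge0.
    apply: le_trans (down_upto_ker _ kg) _; first by rewrite jm.
    by rewrite ler_wpM2r // ler_wpM2r // ler_nat; lia.
  (* Below level [j] there is no new error: at [m.+1 = j] the kernel condition applies, and lower
     down, where [upto R m.+1 j g] is just [g] by truncated subtraction, [c = 0]. *)
  rewrite norm0 ?mulr_ge0 ?ler0n // => x rx; rewrite /E1.
  rewrite delta_prod_out // subrr mul0r subr0.
  have [jE|ne] := eqVneq j m.+1.
    by rewrite -jE upto_id kg ?mulr0 // rx.
  by rewrite /c walk_factor_out ?mul0r //; lia.
rewrite (norm_congr (g := fun x => down pi m.+1 E x + c * E1 x)).
  apply: le_trans (norm_triangle grX measX _ _ (ltnW md)) _.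
  have -> : ((k - m) * k)%:R = ((k - m.+1) * k)%:R + k%:R :> K.
    by rewrite -natrD -mulSnr -subSn ?subSS //; lia.
  rewrite !mulrDl lerD //; apply: le_trans (norm_down grX regX measX _ md) IHn.
move=> x _; rewrite downtoS; last by lia.
rewrite -/H cE /E1.
have -> : down pi m.+1 E x
    = down pi m.+1 (fun y => 1 * H y + (- c) * upto R m.+1 j g y) x.
  by congr (_ / _); apply: eq_bigr => y _; rewrite /E; ring.
by rewrite down_lin; ring.
Qed.

(** * Non-laziness and the value of [1 - P] *)

(** Only the elements covered by [s] contribute, so this is the sum bounded by non-laziness at [s],
    divided by [R m j.-1], which is at least [R j j.-1]. *)
Lemma up_down_indic_le m j s y : (0 < j)%N -> (j <= m <= d)%N -> rk s = j ->
  rk y = m -> (s <= y)%O ->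
  0 <= upto R m j.-1 (down pi j (indic s)) y <= gamma.
Proof.
case: j => // j _ /andP[jm md] rs ry sy /=.
have jd : (j < d)%N by lia.
rewrite (uptoE grX regX) //; last by lia.
set h := down pi j.+1 (indic s).
have h0 x : rk x = j -> 0 <= h x.
  by move=> rx; apply: down_ge0 => // z _; rewrite /Defs.indic ler0n.
have -> : \sum_(x | (rk x == j) && (x <= y)%O) h x = \sum_(x | covers x s) h x.
  rewrite [LHS]big_mkcond [RHS]big_mkcond; apply: eq_bigr => x _.
  rewrite (covers_rk grX _ rs); have [rx|//] := eqVneq (rk x) j => /=.
  have [xs|nxs] := boolP (x <= s)%O; first by rewrite (le_trans xs sy).
  case: ifP => // _; rewrite /h /down big1 ?mul0r // => z c.
  rewrite /Defs.indic; case: eqP => [zs|]; last by rewrite mulr0.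
  by move: nxs; rewrite -zs covers_le.
have H0 : 0 <= \sum_(x | covers x s) h x.
  by apply: sumr_ge0 => x; rewrite (covers_rk grX _ rs) => /andP[/eqP /h0].
rewrite mulr_ge0 ?invr_ge0 ?ler0n //=.
have := nlX (i := j.+1) _ rs; rewrite /= /up -/h => /(_ jd); apply: le_trans.
rewrite ler_wpM2r // lef_pV2 ?ler_nat; first by rewrite (R_le grX regX) // jm.
  by rewrite posrE ltr0n (R_gt0 grX regX) //; lia.
by rewrite posrE ltr0n (R_gt0 grX regX) //; lia.
Qed.

Lemma delta_prod_ratio m j : (j <= m < d)%N ->
  `|1 - dprod j m - (R m j)%:R / (R m.+1 j)%:R|
    <= (m - j).+2%:R * gamma * (R m j)%:R.
Proof.
case/andP => jm md; have g0 : 0 <= gamma by apply: gamma_ge0; lia.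
(* The measure of level [j] is 1, so some element has positive measure. *)
have [s /eqP rs ps] : exists2 s, rk s == j & 0 < pi j s.
  apply/exists_inP; apply: contraT; rewrite negb_exists_in => /forall_inP H.
  have := pi_sum1 grX regX measX (leq_trans jm (ltnW md)).
  rewrite big1 => [/eqP|x rx]; first by rewrite eq_sym oner_eq0.
  apply/eqP; rewrite eq_le leNgt H //=; apply: (pi_ge0 grX measX); last exact/eqP.
  by lia.
have Rpos t : (j <= t <= d)%N -> 0 < (R t j)%:R :> K.
  by move=> ?; rewrite ltr0n (R_gt0 grX regX).
have Rm : 0 < (R m j)%:R :> K by apply: Rpos; lia.
pose V := fun y => (s <= y)%O%:R : K.
pose q := inner m V V.
have uE t y : (j <= t <= d)%N -> rk y = t ->
    upto R t j (indic s) y = (R t j)%:R^-1 * V y.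
  move=> jt ry; rewrite (uptoE grX regX) //; congr (_ * _).
  rewrite big_mkcondr (bigD1 s) /=; last by rewrite rs.
  rewrite /Defs.indic eqxx big1 ?addr0; first by rewrite /V; case: ifP.
  by move=> x /andP[_ /negPf ->]; case: ifP.
have VV y : V y * V y = V y by rewrite /V -natrM mulnb andbb.
have qE : q = (R m j)%:R * pi j s.
  have -> : pi j s = inner j (indic s) (fun=> 1).
    rewrite /inner /Defs.indic (bigD1 s) /=; last by rewrite rs.
    by rewrite eqxx big1 ?addr0 ?mulr1 // => x /andP[_ /negPf ->]; rewrite mul0r mulr0.
  rewrite -(@inner_upto1 m); last by lia.
  rewrite /inner mulr_sumr; apply: eq_bigr => y /eqP ry.
  rewrite uE //; last by lia.
  by rewrite VV; field; rewrite gt_eqF.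
(* The squared norms are [pi j s] and [R m j * pi j s], with [R m j >= 1]. The error in [main] thus
   becomes relative to [V], at no loss. *)
have nV : norm j (indic s) <= norm m V.
  apply: ler_wsqrtr; rewrite -!inner_self -/q qE.
  rewrite /inner (bigD1 s) /=; last by rewrite rs.
  rewrite /Defs.indic eqxx !mulr1 big1 ?addr0; last first.
    by move=> x /andP[_ /negPf ->]; rewrite mul0r mulr0.
  by rewrite ler_peMl ?(ltW ps) // ler1n -(ltr0n K).
have q0 : 0 < q by rewrite qE mulr_gt0.
have main := down_upto (indic s) (introT andP (conj jm md)).
set P := dprod j m in main *.
set W := upto R m j.-1 _ in main; set T := down pi m.+1 _ in main.
set E := (fun x => _) in main.
have VT : inner m V T = (R m.+1 j)%:R^-1 * q.
  rewrite /q /inner mulr_sumr; apply: eq_bigr => y /eqP ry.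
  rewrite mulrCA (down_mul grX regX measX) // VV.
  have [sy|nsy] := boolP (s <= y)%O; last by rewrite /V (negPf nsy) /= !(mul0r, mulr0).
  rewrite (eq_bigr (fun z => pi m.+1 z * (R m.+1 j)%:R^-1)); last first.
    move=> z c; rewrite uE ?(rank_covers grX c) ?ry //; last by lia.
    by rewrite /V (le_trans sy (covers_le c)) mulr1.
  rewrite -mulr_suml (sum_up_pi grX regX measX md ry) /V sy mulr1n.
  by field; rewrite (natR_neq0 grX regX md) gt_eqF // Rpos //; lia.
have VW : 0 <= P * inner m V W <= gamma * q.
  case: (posnP j) => [j0|jp].
    by rewrite /P j0 delta_prod0 mul0r lexx mulr_ge0 // ltW.
  have /andP[P0 P1] : 0 <= P <= 1 by exact: delta_prod_01.
  have pm y : rk y = m -> 0 <= pi m y.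
    by move=> ry; exact: (pi_ge0 grX measX (ltnW md) ry).
  have WV y : rk y = m -> 0 <= V y * W y <= gamma * V y.
    move=> ry; rewrite /V; have [sy|_] := boolP (s <= y)%O.
      by rewrite mul1r mulr1; apply: (@up_down_indic_le m j s y) => //; lia.
    by rewrite mul0r mulr0 lexx.
  have /andP[I0 I1] : 0 <= inner m V W <= gamma * q.
    rewrite /q /inner mulr_sumr; apply/andP; split.
      apply: sumr_ge0 => y /eqP ry; apply: mulr_ge0; first exact: pm.
      by have /andP[] := WV y ry.
    apply: ler_sum => y /eqP ry; rewrite VV [leRHS]mulrCA.
    apply: ler_wpM2l; first exact: pm.
    by have /andP[] := WV y ry.
  rewrite mulr_ge0 //=; apply: le_trans I1; exact: ler_piMl.
have VE : inner m V E = (R m.+1 j)%:R^-1 * q - (1 - P) * ((R m j)%:R^-1 * q)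
                        - P * inner m V W.
  rewrite -VT.
  have -> : (R m j)%:R^-1 * q = inner m V (upto R m j (indic s)).
    rewrite /q /inner mulr_sumr; apply: eq_bigr => y /eqP ry.
    by rewrite uE //; [ring | lia].
  rewrite /inner !mulr_sumr -!sumrB; apply: eq_bigr => y _; rewrite /E; ring.
have bound : `|inner m V E| <= (m - j).+1%:R * gamma * q.
  apply: le_trans (inner_le_norm grX measX _ _ (ltnW md)) _.
  rewrite mulrC; apply: (@le_trans _ _ ((m - j).+1%:R * gamma * norm m V * norm m V)).
    rewrite ler_wpM2r ?norm_ge0 //; apply: le_trans main _.
    by rewrite ler_wpM2l // mulr_ge0.
  by rewrite -mulrA -expr2 (norm_sqr grX measX) // ltnW.
rewrite VE in bound.
have R1 : 0 < (R m.+1 j)%:R :> K by apply: Rpos; lia.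
set a := (R m j)%:R in Rm bound *; set b := (R m.+1 j)%:R in R1 bound *.
(* [q / a] is [pi j s]. Non-laziness adds one [gamma * q] to the iterated error, hence [(m - j).+2];
   dividing by [q / a] then yields the factor [R m j]. *)
have scaled : `|1 - P - a / b| * (q / a) <= (m - j).+2%:R * gamma * q.
  have qa0 : 0 <= q / a by apply: ltW; exact: divr_gt0.
  rewrite -{1}[q / a](ger0_norm qa0) -normrM.
  have -> : (1 - P - a / b) * (q / a)
      = - (b^-1 * q - (1 - P) * (a^-1 * q) - P * inner m V W) - P * inner m V W.
    by field; rewrite !gt_eqF.
  apply: le_trans (ler_normB _ _) _; rewrite normrN.
  have /andP[PW0 PW1] := VW.
  rewrite (ger0_norm PW0) -[X in X * gamma]natr1 [X in _ <= X * q]mulrDl mul1r.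
  by rewrite [leRHS]mulrDl; exact: lerD.
move: scaled; rewrite mulrA ler_pdivrMr // -[X in _ <= X]mulrA [q * a]mulrC mulrA.
by rewrite ler_pM2r.
Qed.

(** * Errors of the walk on a level set *)

(** This bound turns errors relative to [g] into errors relative to [upto R k j g]. *)
Lemma norm_upto_ker_ge k j g : (j <= k <= d)%N -> (0 < d)%N ->
  ker_down rk pi j g ->
  (walk_factor j j k - (k * k)%:R * gamma) * norm j g <= norm k (upto R k j g).
Proof.
case/andP => jk kd d0 kg; have g0 := gamma_ge0 d0.
have [->|n0] := eqVneq (norm j g) 0; first by rewrite mulr0 norm_ge0.
have {n0} n0 : 0 < norm j g by rewrite lt_def n0 norm_ge0.
have jd := leq_trans jk kd.
set F := upto R k j g; set L := walk_factor j j k.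
have near := downto_upto_ker jk jk kd kg.
rewrite -/F -/L upto_id in near.
have e : inner k F F
    = inner j g (fun x => downto pi k j F x - L * g x) + L * inner j g g.
  rewrite (adjoint_upto grX regX measX) ?jk // /inner mulr_sumr -big_split.
  by apply: eq_bigr => x _ /=; ring.
have lo : (L - (k * k)%:R * gamma) * norm j g * norm j g <= norm k F ^+ 2.
  rewrite (norm_sqr grX measX) // e -(norm_sqr grX measX) //.
  have := inner_le_norm grX measX g (fun x => downto pi k j F x - L * g x) jd.
  rewrite ler_norml => /andP[lo _].
  have up : norm j g * norm j (fun x => downto pi k j F x - L * g x)
      <= norm j g * ((k * k)%:R * gamma * norm j g).
    apply: ler_wpM2l; first exact: ltW.
    apply: le_trans near _; apply: ler_wpM2r; first exact: ltW.
    by apply: ler_wpM2r => //; rewrite ler_nat leq_mul2r leq_subr orbT.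
  rewrite expr2; set N := norm j g in lo up *.
  move: lo up; set I := inner _ _ _; set M := norm j _ => lo up.
  have -> : (L - (k * k)%:R * gamma) * N * N
      = - (N * ((k * k)%:R * gamma * N)) + L * (N * N) by ring.
  by rewrite lerD2r; apply: le_trans lo; rewrite lerN2.
(* One factor of [norm k F ^+ 2] is bounded by [norm j g], and [norm j g > 0] is cancelled. *)
rewrite -(ler_pM2r n0); apply: le_trans lo _; rewrite expr2.
apply: ler_wpM2l; first exact: norm_ge0.
by apply: (norm_upto grX regX measX); rewrite jk.
Qed.

(** The contraction [U^k_i] is applied to [downto_upto_ker] at level [i]; for [i < j] the walk
    factor is zero and the ill-formed [upto R i j g] drops out. *)
Lemma lower_walk_near k i j g : (i <= k)%N -> (j <= k <= d)%N -> (0 < d)%N ->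
  ker_down rk pi j g ->
  norm k (fun x => lower_walk R pi k (k - i) (upto R k j g) x
                   - walk_factor j i k * upto R k j g x)
  <= (k * k)%:R * gamma * norm j g.
Proof.
move=> ik /andP[jk kd] d0 kg; have g0 := gamma_ge0 d0.
rewrite /lower_walk subKn //; set F := upto R k j g; set c := walk_factor j i k.
pose E x := 1 * downto pi k i F x + (- c) * upto R i j g x.
rewrite (norm_congr (g := upto R k i E)); last first.
  move=> x _; rewrite /E upto_lin // mul1r mulNr; congr (_ - _).
  have [ji|ij] := leqP j i; first by rewrite upto_upto ?ji.
  by rewrite /c walk_factor_out ?mul0r // ij.
apply: le_trans (norm_upto grX regX measX _ _) _; first by rewrite ik.
apply: (@le_trans _ _ (((k - i) * k)%:R * gamma * norm j g)).
  apply: le_trans (downto_upto_ker ik jk kd kg).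
  rewrite le_eqVlt; apply/predU1P; left; apply: norm_congr => x _.
  by rewrite /E -/c -/F; ring.
apply: ler_wpM2r; first exact: norm_ge0.
by apply: ler_wpM2r => //; rewrite ler_nat leq_mul2r leq_subr orbT.
Qed.

(** The trivial bound, for use when [gamma] is bounded below. *)
Lemma lower_walk_bounded k i (c : K) f : (i <= k <= d)%N -> 0 <= c <= 1 ->
  norm k (fun x => lower_walk R pi k (k - i) f x - c * f x) <= 2 * norm k f.
Proof.
move=> /andP[ik kd] /andP[c0 c1]; rewrite /lower_walk subKn //.
rewrite (norm_congr
  (g := fun x => upto R k i (downto pi k i f) x + (- c) * f x)); last first.
  by move=> x _; ring.
apply: le_trans (norm_triangle grX measX _ _ kd) _.
rewrite norm_scale normrN (ger0_norm c0) mulr_natl mulr2n; apply: lerD; last first.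
  by rewrite ler_piMl ?norm_ge0.
apply: le_trans (norm_upto grX regX measX _ _) _; first by rewrite ik.
by apply: (norm_downto grX regX measX); rewrite ik.
Qed.

(** Each [delta_prod delta j t] with [j <= t] is at most [delta j], so a zero factor forces
    [delta j = 1]; then [delta_prod_ratio] at [m = j], where [R j j = 1], bounds [gamma] below. *)
Lemma walk_factor_eq0 j k : (j <= k <= d)%N -> walk_factor j j k = 0 ->
  1 <= 2 * gamma * (R j.+1 j)%:R.
Proof.
move=> /andP[jk kd] L0.
have jk' : (j < k)%N.
  rewrite ltn_neqAle jk andbT; apply/eqP => jE; move/eqP: L0.
  by rewrite /walk_factor jE big_geq // oner_eq0.
have jd : (j < d)%N by lia.
have /andP[dl0 dl1] := delta_01 jd.
have dE : delta j = 1.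
  apply/eqP; rewrite eq_le dl1 leNgt; apply/negP => dlt.
  suff : 0 < walk_factor j j k by rewrite L0 ltxx.
  rewrite /walk_factor big_nat; apply: prodr_gt0 => t /andP[jt tk].
  rewrite subr_gt0 /delta_prod big_ltn ?ltnS //.
  apply: le_lt_trans dlt; rewrite ler_piMr //.
  have td : (t < d)%N by lia.
  by have /andP[] := delta_prod_01 j.+1 td.
have := delta_prod_ratio (m := j) (j := j).
rewrite leqnn jd => /(_ isT); rewrite delta_prod1 dE subrr sub0r normrN subnn.
rewrite (R_diag grX regX (ltnW jd)) mulr1 ger0_norm ?divr_ge0 ?ler0n //.
by rewrite ler_pdivrMr // ltr0n (R_gt0 grX regX) // leqnSn.
Qed.

(** * Comparison of the eigenvalue with [R i j / R k j] *)

Lemma walk_factor_ratio i j k : (i <= k)%N -> (j <= k <= d)%N -> (0 < k)%N ->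
  `|walk_factor j i k - (R i j)%:R / (R k j)%:R|
    <= 2 * ((k ^ 2 * Rmax R k)%:R * gamma).
Proof.
move=> ik /andP[jk kd] k0.
have g0 : 0 <= gamma by apply: (gamma_ge0); lia.
have [ij|ji] := ltnP i j.
  rewrite (R_out grX regX) // ?mul0r ?subr0; last by lia.
  by rewrite walk_factor_out ?ij // normr0 !mulr_ge0 ?ler0n.
have Rpos t : (i <= t <= k)%N -> 0 < (R t j)%:R :> K.
  by move=> ?; rewrite ltr0n (R_gt0 grX regX) //; lia.
have -> : (R i j)%:R / (R k j)%:R
    = \prod_(i <= t < k) ((R t j)%:R / (R t.+1 j)%:R) :> K.
  have : (forall t, (i <= t <= k)%N -> (R t j)%:R != 0 :> K).
    by move=> t /Rpos; rewrite lt_def => /andP[].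
  move: ik {Rpos kd jk k0} => /subnKC <-; elim: (k - i)%N => [|n IHn] Rn0.
    by rewrite addn0 big_geq // divff // Rn0 // leqnn leq_addr.
  rewrite addnS big_nat_recr /=; last by rewrite leq_addr.
  rewrite -IHn; last by move=> t ?; apply: Rn0; lia.
  have n1 : (R (i + n) j)%:R != 0 :> K by apply: Rn0; lia.
  have n2 : (R (i + n).+1 j)%:R != 0 :> K by apply: Rn0; lia.
  by field; rewrite n1 n2.
apply: le_trans (le_prod_dist (e := k.+1%:R * gamma * (Rmax R k)%:R) _ _ _) _.
- move=> t; rewrite mem_index_iota => ?.
  have /andP[? ?] : 0 <= dprod j t <= 1 by apply: (delta_prod_01); lia.
  by lra.
- move=> t; rewrite mem_index_iota => tk.
  rewrite divr_ge0 ?ler0n // ler_pdivrMr; last by apply: Rpos; lia.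
  by rewrite mul1r ler_nat (R_le grX regX) //; lia.
- move=> t; rewrite mem_index_iota => tk.
  apply: le_trans (delta_prod_ratio _) _; first by lia.
  apply: ler_pM; [by rewrite mulr_ge0 | exact: ler0n | |].
    by apply: ler_wpM2r => //; rewrite ler_nat; lia.
  rewrite ler_nat; apply: (@leq_trans (R k j)); first by rewrite (R_le grX regX) //; lia.
  rewrite /Rmax big_mkord; have jk1 : (j < k.+1)%N by lia.
  exact: (leq_bigmax (Ordinal jk1)).
rewrite size_iota; have -> : (k - i)%:R * (k.+1%:R * gamma * (Rmax R k)%:R)
    = (((k - i) * k.+1) * Rmax R k)%:R * gamma :> K by rewrite !natrM; ring.
rewrite mulrA -natrM; apply: ler_wpM2r => //; rewrite ler_nat mulnA.
(* [k - i] factors, each off by at most [k.+1 * gamma * Rmax R k], and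
   [(k - i) * k.+1 <= 2 * k ^ 2]. *)
by rewrite leq_mul2r; apply/orP; right; nia.
Qed.

End Eposet.

(** * Choice of the constants and passage to relative errors *)

Theorem theorem4p7 (K : realType) :
  exists2 C : K, 0 < C &
  forall (d : nat) (R : nat -> nat -> nat) (delta : nat -> K) (i j k : nat),
    (1 <= i <= k)%N -> (j <= k)%N -> (k <= d)%N ->
    0 < delta i -> delta i.-1 < 1 ->
  exists2 c : K, 0 < c &
  forall (disp : Order.disp_t) (X : finPOrderType disp) (rk : X -> nat)
         (pi : nat -> X -> K) (gamma : K),
    graded_poset d rk -> regular_poset rk R -> induced_measure rk R pi d ->
    is_eposet rk R pi d delta gamma -> nonlazy rk R pi d gamma ->
    let lambda := lower_walk_eigenvalue delta k (k - i) j in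
    approx_eigenvalue rk R pi k j (lower_walk R pi k (k - i))
      lambda (c * gamma)
    /\ `| lambda - (R i j)%:R / (R k j)%:R |
         <= C * ((i ^ 4 * k ^ 2 * Rmax R k)%:R / (delta i * (1 - delta i.-1))
                 * gamma).
Proof.
exists 2 => // d R delta i j k /andP[i1 ik] jk kd di0 di1.
set L := walk_factor delta j j k.
set A : K := (k * k)%:R; have A0 : 0 <= A by exact: ler0n.
have AL0 : 0 <= A / `|L| by rewrite divr_ge0.
have R0 : 0 <= (R j.+1 j)%:R :> K by exact: ler0n.
(* This depends on [delta], [R], [j] and [k] only. The first term gives positivity, the second
   serves [L != 0] (it is zero if [L = 0]), and the third serves [L = 0]. *)
exists (1 + 4 * (A / `|L|) + 4 * (R j.+1 j)%:R); first by lra.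
move=> disp X rk pi gamma grX regX measX epX nlX lambda.
have d0 : (0 < d)%N by lia.
have g0 := gamma_ge0 grX measX nlX d0.
have jkd : (j <= k <= d)%N by rewrite jk.
have lE : lambda = walk_factor delta j i k by exact: lower_walk_eigenvalueE.
split.
  move=> g kg; rewrite lE.
  have near := lower_walk_near grX regX measX epX nlX ik jkd d0 kg.
  have triv : norm2 rk pi k (fun x => lower_walk R pi k (k - i) (upto R k j g) x
      - walk_factor delta j i k * upto R k j g x) <= 2 * norm2 rk pi k (upto R k j g).
    apply: (lower_walk_bounded grX regX measX); first by rewrite ik.
    exact: (walk_factor_01 epX).
  have N0 : 0 <= norm2 rk pi k (upto R k j g) by exact: norm_ge0.
  have /andP[L0 _] := walk_factor_01 epX j j kd.
  (* If [L = 0], then [4 * R j.+1 j * gamma >= 2] and the trivial bound is enough. *)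
  have [Lz|Ln0] := eqVneq L 0.
    have Rg := walk_factor_eq0 grX regX measX epX nlX jkd Lz.
    apply: le_trans triv _; apply: ler_wpM2r => //.
    have := mulr_ge0 AL0 g0; rewrite -/L Lz; nra.
  have {Ln0 L0} Lp : 0 < L by rewrite lt_def Ln0.
  (* For small [gamma] the norm of [upto R k j g] is at least [L / 2] times that of [g]; otherwise
     [4 * (A / L) * gamma] exceeds 2 and the trivial bound applies. *)
  have [Ag|Ag] := leP (A * gamma) (L / 2).
    have ge := norm_upto_ker_ge grX regX measX epX nlX jkd d0 kg.
    apply: le_trans near _; rewrite -/A.
    have n0 : 0 <= norm2 rk pi j g by exact: norm_ge0.
    have half : L / 2 * norm2 rk pi j g <= norm2 rk pi k (upto R k j g).
      apply: le_trans ge; apply: ler_wpM2r => //; rewrite -/L -/A; lra.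
    apply: (@le_trans _ _ (2 * (A / L) * gamma * norm2 rk pi k (upto R k j g))).
      have -> : A * gamma * norm2 rk pi j g
          = 2 * (A / L) * gamma * (L / 2 * norm2 rk pi j g) by field; rewrite gt_eqF.
      apply: ler_wpM2l => //; rewrite !mulr_ge0 // invr_ge0 ltW //.
    apply: ler_wpM2r => //; apply: ler_wpM2r => //.
    rewrite gtr0_norm //; move: AL0; rewrite gtr0_norm // => ?; lra.
  apply: le_trans triv _; apply: ler_wpM2r => //.
  have h : 2 <= 4 * (A / L) * gamma.
    have -> : 4 * (A / L) * gamma = 4 * (A * gamma) / L by field; rewrite gt_eqF.
    by rewrite ler_pdivlMr //; lra.
  apply: le_trans h _; apply: ler_wpM2r => //; rewrite gtr0_norm //; lra.
rewrite lE.
(* For [i = k] both quantities are 1. The case is separate because [delta d] is not confined to the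
   unit interval. *)
have := ik; rewrite leq_eqVlt => /predU1P[iE|ik'].
  rewrite iE /walk_factor big_geq // divff ?subrr ?normr0.
    rewrite !mulr_ge0 ?invr_ge0 ?ler0n // -iE mulr_ge0 ?ltW // subr_gt0.
    exact: di1.
  by rewrite pnatr_eq0 -lt0n (R_gt0 grX regX).
apply: le_trans (walk_factor_ratio grX regX measX epX nlX ik jkd _) _; first by lia.
apply: ler_wpM2l => //; apply: ler_wpM2r => //.
have id : (i < d)%N by lia.
have id' : (i.-1 < d)%N by lia.
have /andP[_ di_le1] := delta_01 epX id.
have /andP[di'0 _] := delta_01 epX id'.
have D0 : 0 < delta i * (1 - delta i.-1) by rewrite mulr_gt0 // subr_gt0.
have D1 : delta i * (1 - delta i.-1) <= 1 by rewrite mulr_ile1 //; lra.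
(* The denominator is at most 1 and [i ^ 4 >= 1], so [k ^ 2 * Rmax R k] is below the stated
   quotient. *)
rewrite ler_pdivlMr //; apply: (@le_trans _ _ (k ^ 2 * Rmax R k)%:R).
  by rewrite ler_piMr ?ler0n.
by rewrite ler_nat -mulnA leq_pmull // expn_gt0 i1.
Qed.
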